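(* Let $\hat{Q}_{\mathrm{pr}} = \hat{R}^\sharp \hat{R}$ be a reference prior precision, with $\hat R\in\mathbb{R}^{n\times n}$ invertible and independent of $\theta$, satisfying $$\hat{R}^\top \hat{R} \preceq R(\theta)^\top R(\theta)$$ for every $\theta$ in the support of the hyperprior $\pi_{\mathrm{hyp}}(\theta)$. Let $\sigma_{\min}>0$ and $\delta_{\min}>0$ be such that $\sigma(\theta) \geq \sigma_{\min}$ and $\delta(\theta) \geq \delta_{\min}$ for every such $\theta$. Let $$(\hat{R}^\sharp)^{-1} A^\sharp P A \hat{R}^{-1} = \hat V\hat\Lambda\hat V^\top$$ be an eigendecomposition with $\hat V\in\mathbb{R}^{n\times n}$ orthogonal and $\hat\Lambda=\mathrm{diag}(\hat\lambda_1,\dots,\hat\lambda_n)$, $\hat\lambda_1\ge\dots\ge\hat\lambda_n$. For $1\le r<n$, let $\hat V_r\in\mathbb{R}^{n\times r}$ consist of the first $r$ columns of $\hat V$, let $\hat\Lambda_r=\mathrm{diag}(\hat\lambda_1,\dots,\hat\lambda_r)$, and define the approximate posterior precision $$\hat{Q}_{\mathrm{post},r} := \delta^2 R^\sharp \left(I + \frac{1}{\sigma^2\delta^2} (R^\sharp)^{-1} \hat{R}^\sharp \hat V_r \hat{\Lambda}_r \hat V_r^\top \hat{R} R^{-1} \right) R,$$ where $R=R(\theta)$, $\delta=\delta(\theta)$, $\sigma=\sigma(\theta)$. Then the log-determinant error $$e_1(r,\theta) := -\frac12\log\frac{|Q_{\mathrm{pr}}|}{|Q_{\mathrm{post}}|}+\frac12\log\frac{|Q_{\mathrm{pr}}|}{|\hat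 Q_{\mathrm{post},r}|}=\frac12\log\frac{|Q_{\mathrm{post}}|}{|\hat Q_{\mathrm{post},r}|}$$ satisfies $$e_1(r,\theta) \leq \frac{1}{2 \sigma^2 \delta^2} \left( r \hat{\lambda}_{r+1} + \sum_{i=r+1}^n \hat{\lambda}_i \right) \leq \frac{1}{2 \sigma_{\min}^2 \delta_{\min}^2} \left( r \hat{\lambda}_{r+1} + \sum_{i=r+1}^n \hat{\lambda}_i \right)$$ for all $\theta$ in the support of the hyperprior.
   Context: Let $M\in\mathbb{R}^{n\times n}$ be a symmetric positive definite (finite element mass) matrix, and let $\mathbb{R}^n_M$ denote $\mathbb{R}^n$ with inner product $\langle x,y\rangle_M=x^\top M y$. For a matrix $F$ with $n$ columns, viewed as a map from $\mathbb{R}^n_M$ to a Euclidean space with the standard inner product, $F^\sharp := M^{-1}F^\top$ denotes its adjoint. $|\cdot|$ denotes the determinant and $\preceq$ is the Loewner order on symmetric matrices. Consider the linear Bayesian inverse problem $y=Am+\varepsilon$ with parameter $m\in\mathbb{R}^n_M$, data $y\in\mathbb{R}^q$, and hyperparameter vector $\theta\in\mathbb{R}^k$ with hyperprior $\pi_{\mathrm{hyp}}$. The forward matrix $A\in\mathbb{R}^{q\times n}$ does not depend on $\theta$. The noise is Gaussian, $\varepsilon\sim\mathcal N(0,Q_\varepsilon^{-1})$, with precision $Q_\varepsilon=\sigma^{-2}P$, where $\sigma=\sigma(\theta)>0$ may depend on $\theta$ and $P\in\mathbb{R}^{q\times q}$ is symmetric positive definite and independent of $\theta$. The Gaussian prior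 on $m$ given $\theta$ has precision $Q_{\mathrm{pr}}=\delta^2R^\sharp R$, where $\delta=\delta(\theta)>0$ and the invertible matrix $R=R(\theta)\in\mathbb{R}^{n\times n}$ may both depend on $\theta$. The posterior precision of $m$ given $\theta$ and $y$ is $$Q_{\mathrm{post}}=Q_{\mathrm{pr}}+A^\sharp Q_\varepsilon A=\delta^2R^\sharp R+\frac1{\sigma^2}A^\sharp PA .$$ *)

(* Defs.v *)
From mathcomp Require Import all_boot all_order all_algebra.
From mathcomp Require Import all_classical all_reals all_analysis.

Set Implicit Arguments.
Unset Strict Implicit.
Unset Printing Implicit Defensive.

Import Order.TTheory GRing.Theory Num.Theory.
Import numFieldNormedType.Exports.

Local Open Scope classical_set_scope.
Local Open Scope ring_scope.

(* R^k, as column vectors, with its Borel sigma-algebra. *)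
Definition borel_cV (K : realType) (k : nat) :=
  g_sigma_algebraType (@open 'cV[K]_k).

(* Topological support of a Borel probability measure on R^k. *)
Definition support_of (K : realType) (k : nat)
    (mu : probability (borel_cV K k) K) : set 'cV[K]_k :=
  [set x | forall U : set 'cV[K]_k, open U -> U x -> (0 < mu U)%E].

Definition possemidefmx (K : realType) (n : nat) (B : 'M[K]_n) : Prop :=
  B^T = B /\ forall x : 'cV[K]_n, 0 <= (x^T *m B *m x) 0 0.

Definition posdefmx (K : realType) (n : nat) (B : 'M[K]_n) : Prop :=
  B^T = B /\ forall x : 'cV[K]_n, x != 0 -> 0 < (x^T *m B *m x) 0 0.

Definition loewner_le (K : realType) (n : nat) (B C : 'M[K]_n) : Prop :=
  [/\ B^T = B, C^T = C & possemidefmx (C - B)].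

(* Adjoint of F : (R^n, <x, y> = x^T M y) -> (R^p, standard). *)
Definition sharp (K : realType) (n p : nat) (M : 'M[K]_n) (F : 'M[K]_(p, n)) :
    'M[K]_(n, p) :=
  invmx M *m F^T.

Definition noise_precision (K : realType) (q : nat) (P : 'M[K]_q) (sigma : K) :
    'M[K]_q :=
  sigma ^- 2 *: P.

Definition prior_precision (K : realType) (n : nat) (M R : 'M[K]_n)
    (delta : K) : 'M[K]_n :=
  delta ^+ 2 *: (sharp M R *m R).

Definition posterior_precision (K : realType) (n q : nat) (M : 'M[K]_n)
    (A : 'M[K]_(q, n)) (P : 'M[K]_q) (R : 'M[K]_n) (delta sigma : K) :
    'M[K]_n :=
  prior_precision M R delta + sharp M A *m noise_precision P sigma *m A.

(* (Rhat^#)^-1 A^# P A Rhat^-1 *)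
Definition preconditioned_hessian (K : realType) (n q : nat) (M : 'M[K]_n)
    (A : 'M[K]_(q, n)) (P : 'M[K]_q) (Rhat : 'M[K]_n) : 'M[K]_n :=
  invmx (sharp M Rhat) *m sharp M A *m P *m A *m invmx Rhat.

Definition eigendecomposition (K : realType) (n : nat) (H V : 'M[K]_n)
    (lam : 'rV[K]_n) : Prop :=
  [/\ V^T *m V = 1%:M,
      forall i j : 'I_n, (i <= j)%N -> lam 0 j <= lam 0 i
    & H = V *m diag_mx lam *m V^T].

Definition first_cols (K : realType) (m n r : nat) (le_rn : (r <= n)%N)
    (B : 'M[K]_(m, n)) : 'M[K]_(m, r) :=
  colsub (widen_ord le_rn) B.

Definition approx_posterior_precision (K : realType) (n r : nat)
    (M R Rhat : 'M[K]_n) (Vr : 'M[K]_(n, r)) (lamr : 'rV[K]_r)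
    (delta sigma : K) : 'M[K]_n :=
  delta ^+ 2 *:
    (sharp M R *m
     (1%:M + (sigma ^+ 2 * delta ^+ 2)^-1 *:
        (invmx (sharp M R) *m sharp M Rhat *m
         Vr *m diag_mx lamr *m Vr^T *m Rhat *m invmx R)) *m
     R).

Definition logdet_error (K : realType) (n : nat)
    (Qpr Qpost Qhat : 'M[K]_n) : K :=
  - (2^-1 * ln (\det Qpr / \det Qpost)) + 2^-1 * ln (\det Qpr / \det Qhat).

(* r lambda_{r+1} + sum_{i = r+1}^n lambda_i; eigenvalues are indexed from 0,
   so lambda_{r+1} is the entry of index r. *)
Definition eigenvalue_tail (K : realType) (n r : nat) (lt_rn : (r < n)%N)
    (lam : 'rV[K]_n) : K :=
  r%:R * lam 0 (Ordinal lt_rn) + \sum_(i < n | (r <= i)%N) lam 0 i.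

(* Main.v *)
Require Import Defs.
From mathcomp Require Import all_boot all_order all_algebra.
From mathcomp Require Import ring lra.
From mathcomp Require Import all_classical all_reals all_analysis.

Set Implicit Arguments.
Unset Strict Implicit.
Unset Printing Implicit Defensive.

Import Order.TTheory GRing.Theory Num.Theory.
Import numFieldNormedType.Exports.

Local Open Scope classical_set_scope.
Local Open Scope ring_scope.

(** Put c = 1 / (sigma^2 delta^2) and S = Rhat R^-1.  The precisions Qpost and
    Qhat share the outer factors delta^2 R^# and R, which cancel in the ratio of
    determinants and leave

      det Qpost / det Qhat = det (I + c S^T H S) / det (I + c S^T H_r S),

    where H = sum_i lambda_i v_i v_i^T is the preconditioned Hessian and H_r the
    sum of its first r terms.  The numerator is therefore reached from the
    denominator by adding the rank-one matrices c lambda_i w_i w_i^T with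
    w_i = S^T v_i, one for each i > r.

    By the matrix determinant lemma [det_rank1_update], adding mu w w^T to X
    multiplies the determinant by 1 + mu w^T X^-1 w.  Every X that occurs is the
    identity plus a positive semidefinite matrix, so that
    0 <= w^T X^-1 w <= w^T w ([resolvent_form_bounds]).  The assumption
    Rhat^T Rhat <= R^T R says that S is a contraction; then so is S^T
    ([contraction_tr]), hence w_i^T w_i <= v_i^T v_i = 1.  Each update thus
    multiplies the determinant by at least 1 and at most
    1 + c lambda_i <= exp (c lambda_i) ([det_rank1_updates]), which gives

      e_1 <= (c / 2) sum_(i > r) lambda_i.

    The eigenvalues are nonnegative because H = F^T P F with F = A Rhat^-1, so adding
    r lambda_(r+1) only weakens this bound, and the last inequality is the
    monotonicity of c in sigma and delta. *)

(** * Quadratic forms and positive semidefinite matrices *)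

Section InnerProduct.
Variable K : realType.

Definition dotmx n (x y : 'cV[K]_n) : K := (x^T *m y) 0 0.

Lemma dotmxC n (x y : 'cV[K]_n) : dotmx x y = dotmx y x.
Proof.
by rewrite /dotmx -[x^T *m y]trmxK trmx_mul trmxK [LHS]mxE.
Qed.

Lemma dotmxDr n (x y z : 'cV[K]_n) : dotmx x (y + z) = dotmx x y + dotmx x z.
Proof. by rewrite /dotmx mulmxDr mxE. Qed.

Lemma dotmxNr n (x y : 'cV[K]_n) : dotmx x (- y) = - dotmx x y.
Proof. by rewrite /dotmx mulmxN mxE. Qed.

Lemma dotmxDl n (x y z : 'cV[K]_n) : dotmx (y + z) x = dotmx y x + dotmx z x.
Proof. by rewrite ![dotmx _ x]dotmxC dotmxDr. Qed.

Lemma dotmxNl n (x y : 'cV[K]_n) : dotmx (- y) x = - dotmx y x.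
Proof. by rewrite ![dotmx _ x]dotmxC dotmxNr. Qed.

Lemma dotmx_mull m n (B : 'M[K]_(m, n)) x y :
  dotmx (B *m x) y = dotmx x (B^T *m y).
Proof. by rewrite /dotmx trmx_mul mulmxA. Qed.

Lemma dotmx_ge0 n (x : 'cV[K]_n) : 0 <= dotmx x x.
Proof.
by rewrite /dotmx mxE; apply: sumr_ge0 => i _; rewrite mxE -expr2 sqr_ge0.
Qed.

Lemma dotmx_eq0 n (x : 'cV[K]_n) : dotmx x x <= 0 -> x = 0.
Proof.
move=> x_le0; have /eqP : dotmx x x = 0 by apply/le_anti; rewrite x_le0 dotmx_ge0.
rewrite /dotmx mxE psumr_eq0; last by move=> i _; rewrite mxE -expr2 sqr_ge0.
move=> /allP x0; apply/colP => i; rewrite [RHS]mxE; apply/eqP.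
by move: (x0 i (mem_index_enum _)); rewrite mxE mulf_eq0 orbb.
Qed.

Lemma quad_dotmxE n (B : 'M[K]_n) (x : 'cV[K]_n) :
  (x^T *m B *m x) 0 0 = dotmx x (B *m x).
Proof. by rewrite /dotmx mulmxA. Qed.

End InnerProduct.

Lemma unitmx_ker0 (K : realType) n (B : 'M[K]_n) :
  (forall x : 'cV[K]_n, B *m x = 0 -> x = 0) -> B \in unitmx.
Proof.
move=> B_inj; rewrite -unitmx_tr -row_free_unit -kermx_eq0.
apply/eqP/row_matrixP => i; rewrite row0; apply: trmx_inj; rewrite trmx0.
apply: B_inj; apply: trmx_inj; rewrite trmx_mul trmxK trmx0 -row_mul.
by rewrite mulmx_ker row0.
Qed.

Lemma posdefmx_unit (K : realType) n (B : 'M[K]_n) :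
  posdefmx B -> B \in unitmx.
Proof.
move=> [_ B_gt0]; apply: unitmx_ker0 => x Bx0; apply/eqP/contraT => /B_gt0.
by rewrite quad_dotmxE Bx0 /dotmx mulmx0 mxE ltxx.
Qed.

Lemma posdefmx_semi (K : realType) n (B : 'M[K]_n) :
  posdefmx B -> possemidefmx B.
Proof.
move=> [B_sym B_gt0]; split=> // x; have [->|/B_gt0/ltW//] := eqVneq x 0.
by rewrite mulmx0 mxE.
Qed.

Lemma possemidefmx_congr (K : realType) n q (P : 'M[K]_q) (F : 'M[K]_(q, n)) :
  possemidefmx P -> possemidefmx (F^T *m P *m F).
Proof.
move=> [P_sym P_ge0]; split; first by rewrite !trmx_mul trmxK P_sym mulmxA.
by move=> x; have := P_ge0 (F *m x); rewrite trmx_mul !mulmxA.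
Qed.

(** * Determinants under rank-one updates *)

(** The Weinstein-Aronszajn identity: block elimination turns the matrix with
    blocks I + A B, A, 0, I into the one with blocks I, A, 0, I + B A by
    factors of determinant 1. *)
Lemma det_addmul_comm (R : comUnitRingType) m n
    (A : 'M[R]_(m, n)) (B : 'M[R]_(n, m)) :
  \det (1%:M + A *m B) = \det (1%:M + B *m A).
Proof.
have E : block_mx 1%:M 0 B 1%:M *m block_mx (1%:M + A *m B) A 0 1%:M
           *m block_mx 1%:M 0 (- B) 1%:M = block_mx 1%:M A 0 (1%:M + B *m A).
  rewrite -mulmxA !mulmx_block !(mul1mx, mul0mx, mulmx0, mulmx1, add0r, addr0).
  by rewrite mulmxN addrK mulmx1 subrr addrC.
move: (congr1 determinant E); rewrite !det_mulmx.
by rewrite !(det_lblock, det_ublock) !det1 !(mul1r, mulr1).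
Qed.

Lemma det_rank1_update (K : realType) n (X : 'M[K]_n) (a : K) (w : 'cV[K]_n) :
  X \in unitmx ->
  \det (X + a *: (w *m w^T)) = \det X * (1 + a * dotmx w (invmx X *m w)).
Proof.
move=> X_unit.
have -> : X + a *: (w *m w^T) = X *m (1%:M + (a *: (invmx X *m w)) *m w^T).
  by rewrite mulmxDr mulmx1 -scalemxAl -scalemxAr -mulmxA mulKVmx.
rewrite det_mulmx det_addmul_comm det_mx11 mxE [1%:M _ _]mxE eqxx.
by rewrite -scalemxAr [X in _ * (1 + X)]mxE.
Qed.

Lemma unitmx_add1 (K : realType) n (B : 'M[K]_n) :
  possemidefmx B -> 1%:M + B \in unitmx.
Proof.
move=> [_ B_ge0]; apply: unitmx_ker0 => x; rewrite mulmxDl mul1mx => x0.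
apply: dotmx_eq0; have := congr1 (dotmx x) x0.
rewrite dotmxDr [RHS]/dotmx mulmx0 [RHS]mxE => /eqP; rewrite addr_eq0 => /eqP ->.
by rewrite oppr_le0 -quad_dotmxE.
Qed.

(** With z = (I + B)^-1 w, the three quantities are 0, z^T z + z^T B z and
    z^T z + 2 z^T B z + |B z|^2. *)
Lemma resolvent_form_bounds (K : realType) n (B : 'M[K]_n) (w : 'cV[K]_n) :
  possemidefmx B -> 0 <= dotmx w (invmx (1%:M + B) *m w) <= dotmx w w.
Proof.
move=> B_psd; have X_unit := unitmx_add1 B_psd; have [B_sym B_ge0] := B_psd.
set z := invmx _ *m w.
have -> : w = z + B *m z by rewrite -[z in z + _]mul1mx -mulmxDl mulKVmx.
have zBz : 0 <= dotmx z (B *m z) by rewrite -quad_dotmxE.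
have := dotmx_ge0 z; have := dotmx_ge0 (B *m z).
rewrite !dotmxDl !dotmxDr (dotmxC (B *m z) z).
by move=> ? ?; apply/andP; split; lra.
Qed.

(** The semidefiniteness and the lower bound are part of the conclusion because
    they are what the next update requires of its starting matrix; with
    [B = 0] they also show that every determinant in play is positive. *)
Lemma det_rank1_updates (K : realType) n (I : Type) (s : seq I) (Q : pred I)
    (mu : I -> K) (w : I -> 'cV[K]_n) (B : 'M[K]_n) :
    (forall i, 0 <= mu i) -> (forall i, dotmx (w i) (w i) <= 1) ->
    possemidefmx B -> 0 < \det (1%:M + B) ->
  let B' := B + \sum_(i <- s | Q i) mu i *: (w i *m (w i)^T) in
  [/\ possemidefmx B', \det (1%:M + B) <= \det (1%:M + B') &
      \det (1%:M + B') <= \det (1%:M + B) * expR (\sum_(i <- s | Q i) mu i)].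
Proof.
move=> mu_ge0 w_le1; elim: s B => [|i s IHs] B B_psd B_gt0 /=.
  by rewrite !big_nil addr0 expR0 mulr1.
rewrite !big_cons; case: ifP => _; last exact: IHs.
rewrite addrA expRD; set B1 := B + _.
have B1_psd : possemidefmx B1.
  have [B_sym B_ge0] := B_psd; split.
    by rewrite /B1 linearD linearZ /= trmx_mul trmxK B_sym.
  move=> x; rewrite quad_dotmxE mulmxDl dotmxDr addr_ge0 -?quad_dotmxE //.
  rewrite -scalemxAr -scalemxAl mxE mulr_ge0 //.
  by rewrite quad_dotmxE -mulmxA -{1}[w i]trmxK -dotmx_mull dotmx_ge0.
have /andP[t_ge0 t_le] := resolvent_form_bounds (w i) B_psd.
have detB1 := det_rank1_update (mu i) (w i) (unitmx_add1 B_psd).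
rewrite -addrA -/B1 in detB1.
have le_BB1 : \det (1%:M + B) <= \det (1%:M + B1).
  by rewrite detB1 ler_peMr ?lerDl ?mulr_ge0 // ltW.
have [B'_psd le_B1B' B'_le] := IHs B1 B1_psd (lt_le_trans B_gt0 le_BB1).
split=> //; first exact: le_trans le_BB1 le_B1B'.
apply: le_trans B'_le _; rewrite mulrA ler_wpM2r ?expR_ge0 // detB1.
apply: ler_wpM2l; first exact: ltW.
apply: le_trans (expR_ge1Dx _); by rewrite lerD2l ler_piMr // (le_trans t_le).
Qed.

(** * Spectral sums *)

Lemma spectral_sumE (K : realType) n p (V : 'M[K]_(n, p)) (lam : 'rV[K]_p) :
  V *m diag_mx lam *m V^T = \sum_i lam 0 i *: (col i V *m (col i V)^T).
Proof.
apply/matrixP => i j; rewrite mul_mx_diag mxE summxE; apply: eq_bigr => l _.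
by rewrite !mxE big_ord1 !mxE mulrCA mulrA.
Qed.

Lemma truncated_spectral_sumE (K : realType) n r (le_rn : (r <= n)%N)
    (V : 'M[K]_n) (lam : 'rV[K]_n) :
  first_cols le_rn V *m diag_mx (first_cols le_rn lam) *m (first_cols le_rn V)^T
  = \sum_(i < n | (i < r)%N) lam 0 i *: (col i V *m (col i V)^T).
Proof.
rewrite spectral_sumE big_ord_narrow; apply: eq_bigr => i _.
have -> : col i (first_cols le_rn V) = col (widen_ord le_rn i) V.
  by apply/colP => j; rewrite !mxE.
by rewrite mxE.
Qed.

Lemma congr_spectral_sumE (K : realType) n (I : finType) (Q : pred I)
    (S : 'M[K]_n) (c : K) (lam : I -> K) (v : I -> 'cV[K]_n) :
  c *: (S^T *m (\sum_(i | Q i) lam i *: (v i *m (v i)^T)) *m S) =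
  \sum_(i | Q i) (c * lam i) *: ((S^T *m v i) *m (S^T *m v i)^T).
Proof.
rewrite mulmx_sumr mulmx_suml scaler_sumr; apply: eq_bigr => i _.
by rewrite -scalemxAr -scalemxAl scalerA trmx_mul trmxK !mulmxA.
Qed.

Lemma eigenvalue_ge0 (K : realType) n (H V : 'M[K]_n) (lam : 'rV[K]_n) i :
  eigendecomposition H V lam -> possemidefmx H -> 0 <= lam 0 i.
Proof.
move=> [V_orth _ HE] [_ H_ge0].
have <- : (V^T *m H *m V) i i = lam 0 i.
  by rewrite HE !mulmxA V_orth mul1mx -mulmxA V_orth mulmx1 mxE eqxx.
have := H_ge0 (col i V).
by rewrite tr_col colE -row_mul mulmxA -row_mul -colE 2!mxE.
Qed.

Lemma orthonormal_col (K : realType) n (V : 'M[K]_n) i :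
  V^T *m V = 1%:M -> dotmx (col i V) (col i V) = 1.
Proof.
by move=> V_orth; rewrite /dotmx tr_col colE mulmxA -row_mul V_orth -colE !mxE eqxx.
Qed.

(** * Contractions *)

(** A matrix and its transpose have the same operator norm.  Here it follows
    from 0 <= |v - S u|^2 with u = S^T v: since v^T S u = |u|^2, expanding gives
    2 |u|^2 <= |v|^2 + |S u|^2 <= |v|^2 + |u|^2. *)
Lemma contraction_tr (K : realType) n (S : 'M[K]_n) :
    (forall x, dotmx (S *m x) (S *m x) <= dotmx x x) ->
  forall v, dotmx (S^T *m v) (S^T *m v) <= dotmx v v.
Proof.
move=> S_contr v; set u := S^T *m v.
have vSu : dotmx v (S *m u) = dotmx u u by rewrite /u [RHS]dotmx_mull trmxK.
have := dotmx_ge0 (v - S *m u); have := S_contr u.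
rewrite dotmxDl !dotmxDr !dotmxNl !dotmxNr (dotmxC (S *m u) v) vSu.
by move=> ? ?; lra.
Qed.

Lemma loewner_contraction (K : realType) n (R Rhat : 'M[K]_n) :
    R \in unitmx -> loewner_le (Rhat^T *m Rhat) (R^T *m R) ->
  forall x, dotmx (Rhat *m invmx R *m x) (Rhat *m invmx R *m x) <= dotmx x x.
Proof.
move=> R_u [_ _ [_ D_ge0]] x; have := D_ge0 (invmx R *m x).
rewrite quad_dotmxE mulmxBl dotmxDr dotmxNr subr_ge0 -!mulmxA.
have gram (F : 'M[K]_n) y : dotmx y (F^T *m (F *m y)) = dotmx (F *m y) (F *m y).
  by rewrite dotmx_mull.
by rewrite !gram mulKVmx.
Qed.

(** * Factored forms of the precisions *)

Lemma sharp_unit (K : realType) n (M R : 'M[K]_n) :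
  M \in unitmx -> R \in unitmx -> sharp M R \in unitmx.
Proof. by move=> M_u R_u; rewrite unitmx_mul unitmx_inv M_u unitmx_tr. Qed.

(** The mass matrix cancels, which is why the preconditioned Hessian is
    symmetric in the standard inner product. *)
Lemma invmx_sharpM (K : realType) n p (M R : 'M[K]_n) (F : 'M[K]_(p, n)) :
    M \in unitmx -> R \in unitmx ->
  invmx (sharp M R) *m sharp M F = (invmx R)^T *m F^T.
Proof.
move=> M_u R_u; rewrite -[RHS](mulKmx (sharp_unit M_u R_u)); congr (_ *m _).
by rewrite /sharp !mulmxA -(mulmxA (invmx M)) -trmx_mul mulVmx // trmx1 mulmx1.
Qed.

Lemma preconditioned_hessianE (K : realType) n q (M : 'M[K]_n)
    (A : 'M[K]_(q, n)) (P : 'M[K]_q) (R : 'M[K]_n) :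
    M \in unitmx -> R \in unitmx ->
  preconditioned_hessian M A P R = (A *m invmx R)^T *m P *m (A *m invmx R).
Proof.
move=> M_u R_u.
by rewrite /preconditioned_hessian invmx_sharpM // -trmx_mul !mulmxA.
Qed.

Lemma posterior_precisionE (K : realType) n q (M : 'M[K]_n)
    (A : 'M[K]_(q, n)) (P : 'M[K]_q) (R Rhat : 'M[K]_n) (delta sigma : K) :
    M \in unitmx -> R \in unitmx -> Rhat \in unitmx ->
    delta != 0 -> sigma != 0 ->
  let S := Rhat *m invmx R in
  posterior_precision M A P R delta sigma =
  delta ^+ 2 *: (sharp M R *m (1%:M + (sigma ^+ 2 * delta ^+ 2)^-1 *:
    (S^T *m preconditioned_hessian M A P Rhat *m S)) *m R).
Proof.
move=> M_u R_u Rh_u d0 s0 S.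
rewrite preconditioned_hessianE // mulmxDr mulmxDl mulmx1 scalerDr; congr (_ + _).
rewrite -!scalemxAr -!scalemxAl scalerA.
have -> : delta ^+ 2 * (sigma ^+ 2 * delta ^+ 2)^-1 = sigma ^- 2.
  by field; rewrite d0 s0.
congr (_ *: _).
set B := A *m invmx Rhat.
(* In terms of B and S, no inverse of R or Rhat is left on either side. *)
have -> : A = B *m S *m R by rewrite /B /S !mulmxA !mulmxKV.
by rewrite /sharp !trmx_mul !mulmxA.
Qed.

Lemma approx_posterior_precisionE (K : realType) n r (M R Rhat : 'M[K]_n)
    (Vr : 'M[K]_(n, r)) (lamr : 'rV[K]_r) (delta sigma : K) :
    M \in unitmx -> R \in unitmx ->
  let S := Rhat *m invmx R in
  approx_posterior_precision M R Rhat Vr lamr delta sigma =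
  delta ^+ 2 *: (sharp M R *m (1%:M + (sigma ^+ 2 * delta ^+ 2)^-1 *:
    (S^T *m (Vr *m diag_mx lamr *m Vr^T) *m S)) *m R).
Proof.
move=> M_u R_u S.
by rewrite /approx_posterior_precision invmx_sharpM // -trmx_mul !mulmxA.
Qed.

(** With X = I + c S^T H S or X = I + c S^T H_r S this separates the prior
    determinant from the part that carries the error. *)
Lemma det_precision (K : realType) n (M R X : 'M[K]_n) (delta : K) :
  \det (delta ^+ 2 *: (sharp M R *m X *m R)) =
  \det (prior_precision M R delta) * \det X.
Proof. by rewrite /prior_precision !detZ !det_mulmx; ring. Qed.

(** det Qpr cancels inside each logarithm of the error, which leaves ln (1 / a)
    and ln (1 / b); a and b are positive, so the two can be combined. *)
Lemma logdet_errorE (K : realType) n (Qpr Qpost Qhat : 'M[K]_n) (a b : K) :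
    \det Qpr != 0 -> 0 < a -> 0 < b ->
    \det Qpost = \det Qpr * a -> \det Qhat = \det Qpr * b ->
  \det Qpost / \det Qhat = a / b /\
  logdet_error Qpr Qpost Qhat = 2^-1 * ln (a / b).
Proof.
move=> Q0 a_gt0 b_gt0 postE hatE; split.
  by rewrite postE hatE -mulf_div divff // mul1r.
rewrite /logdet_error postE hatE !invfM !mulrA divff // !mul1r ln_div //.
by rewrite !lnV //; ring.
Qed.

(** * The log-determinant error *)

Theorem theorem4p1 (K : realType) (n q k : nat)
  (M : 'M[K]_n) (M_spd : posdefmx M)
  (A : 'M[K]_(q, n))
  (P : 'M[K]_q) (P_spd : posdefmx P)
  (pi_hyp : probability (borel_cV K k) K)
  (sigma delta : 'cV[K]_k -> K)
  (R : 'cV[K]_k -> 'M[K]_n)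
  (sigma_gt0 : forall theta, support_of pi_hyp theta -> 0 < sigma theta)
  (delta_gt0 : forall theta, support_of pi_hyp theta -> 0 < delta theta)
  (R_inv : forall theta, support_of pi_hyp theta -> R theta \in unitmx)
  (Rhat : 'M[K]_n) (Rhat_inv : Rhat \in unitmx)
  (Rhat_le : forall theta, support_of pi_hyp theta ->
     loewner_le (Rhat^T *m Rhat) ((R theta)^T *m R theta))
  (sigma_min delta_min : K)
  (sigma_min_gt0 : 0 < sigma_min) (delta_min_gt0 : 0 < delta_min)
  (sigma_ge : forall theta, support_of pi_hyp theta -> sigma_min <= sigma theta)
  (delta_ge : forall theta, support_of pi_hyp theta -> delta_min <= delta theta)
  (Vhat : 'M[K]_n) (lam : 'rV[K]_n)
  (Vhat_lam : eigendecomposition (preconditioned_hessian M A P Rhat) Vhat lam)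
  (r : nat) (r_ge1 : (1 <= r)%N) (r_lt_n : (r < n)%N) :
  forall theta, support_of pi_hyp theta ->
    let Qpr := prior_precision M (R theta) (delta theta) in
    let Qpost :=
      posterior_precision M A P (R theta) (delta theta) (sigma theta) in
    let Qhat :=
      approx_posterior_precision M (R theta) Rhat
        (first_cols (ltnW r_lt_n) Vhat) (first_cols (ltnW r_lt_n) lam)
        (delta theta) (sigma theta) in
    let e1 := logdet_error Qpr Qpost Qhat in
    [/\ e1 = 2^-1 * ln (\det Qpost / \det Qhat),
        e1 <= (2 * sigma theta ^+ 2 * delta theta ^+ 2)^-1 *
                eigenvalue_tail r_lt_n lam
      & (2 * sigma theta ^+ 2 * delta theta ^+ 2)^-1 *
          eigenvalue_tail r_lt_n lam
        <= (2 * sigma_min ^+ 2 * delta_min ^+ 2)^-1 *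
             eigenvalue_tail r_lt_n lam].
Proof.
move=> theta supp_theta Qpr Qpost Qhat e1.
have s_gt0 := sigma_gt0 _ supp_theta; have d_gt0 := delta_gt0 _ supp_theta.
have R_u := R_inv _ supp_theta; have M_u := posdefmx_unit M_spd.
pose c := (sigma theta ^+ 2 * delta theta ^+ 2)^-1.
pose S := Rhat *m invmx (R theta).
pose w i := S^T *m col i Vhat.
have [V_orth _ HE] := Vhat_lam.
have c_gt0 : 0 < c by rewrite invr_gt0 mulr_gt0 // exprn_gt0.
have lam_ge0 i : 0 <= lam 0 i.
  apply: eigenvalue_ge0 Vhat_lam _; rewrite preconditioned_hessianE //.
  exact/possemidefmx_congr/posdefmx_semi.
have mu_ge0 i : 0 <= c * lam 0 i by rewrite mulr_ge0 // ltW.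
have w_le1 i : dotmx (w i) (w i) <= 1.
  rewrite -(orthonormal_col i V_orth); apply: contraction_tr.
  exact: loewner_contraction (Rhat_le _ supp_theta).
pose C (Q : pred 'I_n) := \sum_(i < n | Q i) (c * lam 0 i) *: (w i *m (w i)^T).
have zero_psd : possemidefmx (0 : 'M[K]_n).
  by split=> [|x]; rewrite ?trmx0 // mulmx0 mul0mx mxE.
(* From I to I + c S^T H_r S: this makes the latter a legitimate starting
   matrix, with positive determinant, for the remaining updates. *)
have [] := @det_rank1_updates K n _ (index_enum 'I_n) (fun i => (i < r)%N)
  (fun i => c * lam 0 i) w 0 mu_ge0 w_le1 zero_psd.
  by rewrite addr0 det1.
rewrite add0r -/(C _) addr0 det1 => Cr_psd le1_Cr _.
have Cr_gt0 := lt_le_trans ltr01 le1_Cr.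
(* From I + c S^T H_r S to I + c S^T H S. *)
have [_ le_Cr_C C_le] := @det_rank1_updates K n _ (index_enum 'I_n)
  (fun i => (r <= i)%N) (fun i => c * lam 0 i) w _ mu_ge0 w_le1 Cr_psd Cr_gt0.
have CrC : C (fun i => (i < r)%N) + C (fun i => (r <= i)%N) = C predT.
  rewrite [RHS](bigID (fun i : 'I_n => (i < r)%N)) /=; congr (_ + _).
  by apply: eq_bigl => i; rewrite leqNgt.
rewrite -/(C _) CrC in le_Cr_C C_le.
have C_gt0 := lt_le_trans Cr_gt0 le_Cr_C.
have Qpr0 : \det Qpr != 0.
  rewrite -unitfE -unitmxE unitmxZ ?unitfE ?expf_neq0 ?gt_eqF //.
  by rewrite unitmx_mul sharp_unit.
have postE : \det Qpost = \det Qpr * \det (1%:M + C predT).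
  rewrite /Qpost (@posterior_precisionE _ _ _ M _ _ _ Rhat) ?gt_eqF //.
  rewrite det_precision HE spectral_sumE.
  by rewrite congr_spectral_sumE.
have hatE : \det Qhat = \det Qpr * \det (1%:M + C (fun i => (i < r)%N)).
  rewrite /Qhat approx_posterior_precisionE // det_precision.
  by rewrite truncated_spectral_sumE congr_spectral_sumE.
have [ratioE e1E] := logdet_errorE Qpr0 C_gt0 Cr_gt0 postE hatE.
have tail_ge0 : 0 <= \sum_(i < n | (r <= i)%N) lam 0 i by apply: sumr_ge0.
have head_ge0 : 0 <= r%:R * lam 0 (Ordinal r_lt_n) by rewrite mulr_ge0.
split; first by rewrite ratioE.
  rewrite /e1 e1E -mulrA invfM -/c -mulrA ler_pM2l ?invr_gt0 //.
  apply: (@le_trans _ _ (c * \sum_(i < n | (r <= i)%N) lam 0 i)).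
    rewrite mulr_sumr -ler_expR lnK ?posrE ?divr_gt0 //.
    by rewrite ler_pdivrMr // mulrC.
  by rewrite ler_pM2l // lerDr.
rewrite ler_wpM2r ?addr_ge0 // lef_pV2 ?posrE ?mulr_gt0 ?exprn_gt0 //.
have sqr_mono (x y : K) : 0 < x -> x <= y -> x ^+ 2 <= y ^+ 2.
  by move=> x_gt0 le_xy; rewrite ler_pXn2r ?nnegrE // ltW // (lt_le_trans x_gt0).
rewrite -!(mulrA 2) ler_pM2l //; apply: ler_pM; rewrite ?sqr_ge0 //.
- exact: sqr_mono _ _ sigma_min_gt0 (sigma_ge _ supp_theta).
- exact: sqr_mono _ _ delta_min_gt0 (delta_ge _ supp_theta).
Qed.
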